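(* Let $f$ be convex, let $\mathcal{C}$ be closed and convex, let $h$ be the reference function with Bregman divergence $D$, assume $x_0\in\mathcal{C}\cap\operatorname{int}(\mathcal{X})$ and $x_\star\in\operatorname{ri}(\mathcal{C})\cap\operatorname{int}(\mathcal{X})$, and let $(x_t)_{t\ge 0}$ be the iterates of mirror Polyak, all as specified in the context. If $f$ is $L$-smooth and $\mu$-strongly convex relative to $h$, with $L,\mu>0$, then for every integer $t\ge 0$, $$ f(x_t)-f_\star\le\left(1-\frac{\mu}{L+\mu}\right)^{t}\max\left\{f(x_0)-f_\star,\; L\,D(x_\star,x_0)\right\}.$$
   Context: Setting: $\mathcal{X}\subseteq\mathbb{R}^d$ is convex with nonempty interior, $f:\mathcal{X}\to\mathbb{R}$ is a proper convex function, and $\mathcal{C}\subseteq\mathbb{R}^d$ is a closed convex set such that $f$ attains a finite minimum $f_\star := f(x_\star)$ over $\mathcal{X}\cap\mathcal{C}$ at a point $x_\star\in\mathcal{X}\cap\mathcal{C}$. $g(x)\in\partial f(x)$ denotes a fixed selection of a subgradient of $f$ at $x$. The reference function $h:\mathcal{X}\to\mathbb{R}$ is a convex function of Legendre type with domain $\mathcal{X}$ (closed proper convex, essentially smooth, strictly convex on $\operatorname{int}(\mathcal{X})$; essentially smooth means that $h$ is differentiable on the nonempty set $\operatorname{int}(\mathcal{X})$ and $\|\nabla h(x_k)\|\to\infty$ whenever $(x_k)$ is a sequence in $\operatorname{int}(\mathcal{X})$ converging to a boundary point of $\mathcal{X}$). Its Bregman divergence is $D(x,y):=h(x)-h(y)-\langle\nabla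 h(y),x-y\rangle$ for $x\in\mathcal{X}$, $y\in\operatorname{int}(\mathcal{X})$. $\operatorname{ri}$ denotes relative interior, $\operatorname{int}$ interior. Mirror Polyak: starting from $x_0\in\mathcal{C}\cap\operatorname{int}(\mathcal{X})$, for every $t\ge0$, $$x_{t+1}\in\arg\min_{x\in\mathcal{X}\cap\mathcal{C}} D(x,x_t)\quad\text{such that}\quad f(x_t)+\langle g(x_t),x-x_t\rangle=f_\star .$$ Relative geometry: $f$ is $L$-smooth relative to $h$ if $f(y)\le f(x)+\langle g(x),y-x\rangle+L\,D(y,x)$ for all $x\in\operatorname{int}(\mathcal{X})$, $y\in\mathcal{X}$; $f$ is $\mu$-strongly convex relative to $h$ if $f(y)\ge f(x)+\langle g(x),y-x\rangle+\mu\,D(y,x)$ for all $x\in\operatorname{int}(\mathcal{X})$, $y\in\mathcal{X}$. *)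

(* Defs.v *)
From HB Require Import structures.
From mathcomp Require Import all_boot all_order all_algebra.
From mathcomp Require Import all_classical all_reals all_analysis.

Set Implicit Arguments.
Unset Strict Implicit.
Unset Printing Implicit Defensive.

Import Order.TTheory GRing.Theory Num.Theory.
Import numFieldNormedType.Exports.

Local Open Scope classical_set_scope.
Local Open Scope ring_scope.

(* A real-valued function on a set X is represented by a
   total function on 'rV[R]_d of which only the values on X are constrained. *)

Section MirrorPolyak.
Context {R : realType} {d : nat}.
Notation E := 'rV[R]_d.
Implicit Types (X C A : set E) (f h phi : E -> R) (g : E -> E).

Definition dotp (u v : E) : R := (u *m v^T) 0 0.

(* The Euclidean norm; the library norm of 'rV[R]_d is the sup norm, which
   induces the same topology. *)
Definition enorm (u : E) : R := Num.sqrt (dotp u u).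

Definition gradient h (y : E) : E := \row_(j < d) 'D_(delta_mx 0 j) h y.

Definition affine_set A :=
  forall (x y : E) (t : R), A x -> A y -> A ((1 - t) *: x + t *: y).

Definition affine_hull A : set E := smallest affine_set A.

Definition relative_interior C : set E :=
  [set x | C x /\ \forall y \near x, affine_hull C y -> C y].

Definition is_argmin A phi (x : E) := A x /\ forall y : E, A y -> phi x <= phi y.

Definition subdifferential X f (x : E) : set E :=
  [set v | forall y : E, X y -> f x + dotp v (y - x) <= f y].

Definition strictly_convex_on A h :=
  forall (x y : E) (t : R), A x -> A y -> x != y -> 0 < t < 1 ->
    h ((1 - t) *: x + t *: y) < (1 - t) * h x + t * h y.

(* A proper convex function is closed iff it is lower semicontinuous as an
   extended-real-valued function, equal to +oo off its domain. *)
Definition closed_function X h :=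
  lower_semicontinuous (fun x : E => if x \in X then (h x)%:E else +oo%E).

(* Boundary points of X are taken in closure X and need not belong to X. *)
Definition essentially_smooth X h :=
  [/\ X° !=set0,
      (forall x : E, X° x -> differentiable h x) &
      forall (u : nat -> E) (x : E), (forall k, X° (u k)) ->
        (closure X `\` X°) x -> u @ \oo --> x ->
        enorm (gradient h (u k)) @[k --> \oo] --> +oo].

Definition legendre_type X h :=
  [/\ convex_function X h, closed_function X h, essentially_smooth X h &
      strictly_convex_on X° h].

(* Meaningful for x in X and y in the interior of X. *)
Definition bregman h (x y : E) : R :=
  h x - h y - dotp (gradient h y) (x - y).

Definition relatively_smooth X f g h (L : R) :=
  forall x y : E, X° x -> X y ->
    f y <= f x + dotp (g x) (y - x) + L * bregman h y x.

Definition relatively_strongly_convex X f g h (mu : R) :=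
  forall x y : E, X° x -> X y ->
    f y >= f x + dotp (g x) (y - x) + mu * bregman h y x.

Definition mirror_polyak X C f g h (fstar : R) (x : nat -> E) :=
  (C `&` X°) (x 0%N) /\
  forall t, is_argmin
    [set y | (X `&` C) y /\ f (x t) + dotp (g (x t)) (y - x t) = fstar]
    (fun y => bregman h y (x t)) (x t.+1).

End MirrorPolyak.

(* Main.v *)
Require Import Defs.
From mathcomp Require Import all_boot all_order all_algebra.
From mathcomp Require Import all_classical all_reals all_analysis.
From mathcomp Require Import ring lra.
(** Write delta_t for f(x_t) - f(xstar) and D_t for the divergence
    D(xstar, x_t). The iterate x_{t+1} is the Bregman projection of x_t onto a
    hyperplane section of X `&` C, and everything about that projection is
    extracted from a single multiplier lam >= 0, which acts as the step size
    of a mirror descent step: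
      D(x_{t+1}, x_t) <= lam * delta_t   and
      D_{t+1} + D(x_{t+1}, x_t) <= (1 - lam * mu) * D_t
    ([bregman_projection_multiplier], relative strong convexity being used at
    x_t). Relative smoothness and the hyperplane equation give
      delta_{t+1} <= L * D(x_{t+1}, x_t).
    Hence, up to time t, delta is contracted by the product of the L * lam_i
    and also bounded by L * D_0 times the product of the 1 - lam_i * mu. A
    short step makes the first factor small, a long step the second. The
    weighted combination mu * (L * lam) + L * (1 - lam * mu) is the constant
    L, so by a weighted AM-GM argument the two products cannot both exceed
    (L / (L + mu)) ^ t ([two_rate_contraction]).

    The multiplier needs no duality theory, because only the two points x_t
    and xstar have to be controlled. The affine model of f at x_t is above
    f(xstar) at x_t and below it at xstar, so the segment between them meets
    the hyperplane; the variational inequality of the projection at that one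
    point is the required balance between its two endpoints. The variational
    inequality requires h to be differentiable at x_{t+1}, that is, x_{t+1}
    interior to X; this is where essential smoothness enters
    ([bregman_argmin_interior]). *)

Import Order.TTheory GRing.Theory Num.Theory.
Import numFieldNormedType.Exports.
Local Open Scope classical_set_scope.
Local Open Scope ring_scope.

Set Implicit Arguments.
Unset Strict Implicit.
Unset Printing Implicit Defensive.

(** * The pairing and convexity along segments *)

Section Dotp.
Context {R : realType} {d : nat}.
Implicit Types u v w : 'rV[R]_d.

Lemma dotpE u v : dotp u v = \sum_(j < d) u 0 j * v 0 j.
Proof. by rewrite /dotp mxE; apply: eq_bigr => j _; rewrite mxE. Qed.

Lemma dotpDr u v w : dotp u (v + w) = dotp u v + dotp u w.
Proof. by rewrite /dotp linearD mulmxDr mxE. Qed.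

Lemma dotpZr u (a : R) v : dotp u (a *: v) = a * dotp u v.
Proof. by rewrite /dotp linearZ -scalemxAr mxE. Qed.

Lemma dotpBr u v w : dotp u (v - w) = dotp u v - dotp u w.
Proof. by rewrite dotpDr -scaleN1r dotpZr mulN1r. Qed.

Lemma dotpBl u v w : dotp (u - v) w = dotp u w - dotp v w.
Proof. by rewrite /dotp mulmxBl !mxE. Qed.

Lemma dotp_delta u j : dotp u (delta_mx 0 j) = u 0 j.
Proof.
rewrite dotpE (bigD1 j)//= mxE !eqxx mulr1 big1 ?addr0// => i ij.
by rewrite mxE (negPf ij) andbF mulr0.
Qed.

End Dotp.

Section Segments.
Context {R : realType} {V : normedModType R}.
Implicit Types (X : set V) (h : V -> R) (x y z : V) (s : R).

Lemma convex_set_segment X x y s : convex_set X -> X x -> X y ->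
  0 <= s <= 1 -> X (x + s *: (y - x)).
Proof.
move=> cX Xx Xy /andP[s0 s1].
have := cX y x (Itv01 s0 s1); rewrite !inE => /(_ Xy Xx).
congr X; rewrite /conv/=.
by rewrite scalerBr [in RHS]addrCA; congr (_ + _); rewrite scalerBl scale1r.
Qed.

Lemma convex_function_segment X h x y s : convex_function X h -> X x -> X y ->
  0 <= s <= 1 -> h (x + s *: (y - x)) <= h x + s * (h y - h x).
Proof.
move=> cX Xx Xy /andP[s0 s1].
have -> : x + s *: (y - x) = s *: y + (1 - s) *: x.
  by rewrite scalerBr scalerBl scale1r addrCA.
have : h (s *: y + (1 - s) *: x) <= s * h y + (1 - s) * h x.
  by apply: (cX (Itv01 s0 s1) y x); rewrite inE.
by move=> ?; lra.
Qed.

(** The homothety of centre [x] and ratio 1 / s is continuous and maps the point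
    of the segment to [z]; pulling a neighbourhood of [z] inside [X] back along
    it yields a neighbourhood of the point, inside [X] by convexity. *)
Lemma convex_set_segment_interior X x z s : convex_set X -> X x -> X° z ->
  0 < s <= 1 -> X° (x + s *: (z - x)).
Proof.
move=> cX Xx zX /andP[s0 s1]; have sn : s != 0 by rewrite gt_eqF.
pose k w := x + s^-1 *: (w - x).
have ck : k w @[w --> x + s *: (z - x)] --> k (x + s *: (z - x)).
  apply: cvgD; first exact: cvg_cst.
  by apply: cvgZl_tmp; apply: cvgB; [exact: cvg_id | exact: cvg_cst].
have kz : k (x + s *: (z - x)) = z.
  by rewrite /k [x + s *: _]addrC addrK scalerA mulVf// scale1r subrKC.
have : \forall w \near x + s *: (z - x), X (k w) by apply: ck; rewrite kz.
apply: filterS => w Xk.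
have -> : w = x + s *: (k w - x).
  by rewrite /k (addrAC x) subrr add0r scalerA mulfV// scale1r subrKC.
by apply: convex_set_segment => //; rewrite (ltW s0).
Qed.

End Segments.

(** * First-order inequalities and Bregman projections *)

Section Gradient.
Context {R : realType} {d : nat}.
Implicit Types (X K : set 'rV[R]_d) (h : 'rV[R]_d -> R) (x y z v : 'rV[R]_d).

Lemma dotp_gradient h y v : differentiable h y ->
  dotp (gradient h y) v = 'D_v h y.
Proof.
move=> dh; rewrite deriveE// [in RHS](row_sum_delta v) linear_sum dotpE.
apply: eq_bigr => j _; rewrite linearZ/= mxE mulrC; congr (_ * _).
by rewrite deriveE.
Qed.

Lemma gradient_cvg h y v : differentiable h y ->
  (h (y + s *: v) - h y) / s @[s --> 0^'+] --> dotp (gradient h y) v.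
Proof.
move=> dh; rewrite dotp_gradient//; apply: cvg_dnbhs_at_right.
have := @diff_derivable _ _ _ h y v dh; rewrite /derivable /derive => /cvgP.
apply: cvg_trans; apply: near_eq_cvg; near=> s => /=.
by rewrite mulrC [y + _]addrC.
Unshelve. all: by end_near. Qed.

(** Together with [dotp_gradient_le], reads first-order information off bounds
    along a segment; only positive increments are available there, hence the
    right-hand limit. *)
Lemma le_dotp_gradient h y v (c : R) : differentiable h y ->
  (forall s, 0 < s <= 1 -> h y + s * c <= h (y + s *: v)) ->
  c <= dotp (gradient h y) v.
Proof.
move=> dh H; apply: (cvgr_to_ge (gradient_cvg dh)).
near=> s; have s0 : 0 < s by near: s; exact: nbhs_right_gt.
rewrite ler_pdivlMr// lerBrDl mulrC; apply: H; rewrite s0/=.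
by near: s; apply: nbhs_right_ltW.
Unshelve. all: by end_near. Qed.

Lemma dotp_gradient_le h y v (c : R) : differentiable h y ->
  (forall s, 0 < s <= 1 -> h (y + s *: v) <= h y + s * c) ->
  dotp (gradient h y) v <= c.
Proof.
move=> dh H; apply: (cvgr_to_le (gradient_cvg dh)).
near=> s; have s0 : 0 < s by near: s; exact: nbhs_right_gt.
rewrite ler_pdivrMr// lerBlDl mulrC; apply: H; rewrite s0/=.
by near: s; apply: nbhs_right_ltW.
Unshelve. all: by end_near. Qed.

Lemma bregman_ge0 X h x y : convex_function X h -> X x -> X y ->
  differentiable h y -> 0 <= bregman h x y.
Proof.
move=> ch Xx Xy dh; rewrite /bregman subr_ge0; apply: dotp_gradient_le => // s.
move=> /andP[s0 s1].
by apply: (convex_function_segment ch) => //; rewrite (ltW s0).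
Qed.

Lemma bregman_three_points h x y z :
  bregman h x z = bregman h x y + bregman h y z
    + dotp (gradient h y - gradient h z) (x - y).
Proof. rewrite /bregman !(dotpBr, dotpBl); ring. Qed.

Lemma bregman_symm h x y : bregman h x y + bregman h y x =
  - dotp (gradient h x - gradient h y) (y - x).
Proof. rewrite /bregman !(dotpBr, dotpBl); ring. Qed.

(** First-order information that does not need the minimiser [y] to be interior:
    it is what remains of the variational inequality at a point where [h] may
    fail to be differentiable. *)
Lemma bregman_argmin_segment K h x y p s : convex_set K ->
  is_argmin K (fun q => bregman h q x) y -> K p -> 0 <= s <= 1 ->
  h y + s * dotp (gradient h x) (p - y) <= h (y + s *: (p - y)).
Proof.
move=> cK [Ky ymin] Kp s01.
have := ymin _ (convex_set_segment cK Ky Kp s01).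
rewrite /bregman !(dotpBr, dotpDr, dotpZr) => H; lra.
Qed.

Lemma bregman_argmin_variational K h x y p : convex_set K ->
  is_argmin K (fun q => bregman h q x) y -> differentiable h y -> K p ->
  0 <= dotp (gradient h y - gradient h x) (p - y).
Proof.
move=> cK ymin dh Kp; rewrite dotpBl subr_ge0; apply: le_dotp_gradient => // s.
move=> /andP[s0 s1]; apply: (bregman_argmin_segment cK ymin Kp).
by rewrite (ltW s0).
Qed.

(** Otherwise [y] is a boundary point, and moving from [y] towards [z] one
    enters the interior of [X] at once. Minimality bounds from below the slope of
    [h] in the direction z - y along this segment, and convexity of [h] on a
    ball around [z] turns that one-directional bound into a bound on the whole
    gradient. This contradicts the blow-up of the gradient at the boundary. *)
Lemma bregman_argmin_interior X K h x y z :
  convex_set X -> convex_function X h -> essentially_smooth X h ->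
  convex_set K -> K `<=` X -> is_argmin K (fun q => bregman h q x) y ->
  (K `&` X°) z -> X° y.
Proof.
move=> cX ch [_ dh blowup] cK KX ymin [Kz zX]; apply: contrapT => yNint.
have Ky : K y := proj1 ymin.
have Xy : X y := KX _ Ky.
pose a := dotp (gradient h x) (z - y).
pose u (s : R) := y + s *: (z - y).
have uX s : 0 < s <= 1 -> X° (u s) by exact: convex_set_segment_interior.
have [r r0 rX] : exists2 r : R, 0 < r &
    forall e : 'rV[R]_d, `|e| < r -> X (z + e).
  have /nbhs_ballP[r /= r0 rX] : nbhs z X by [].
  exists r => // e er; apply: rX; rewrite -ball_normE /= opprD addrA subrr.
  by rewrite sub0r normrN.
(* The gradient inequality at u s, tested at z + w, is combined with the one
   tested at y; the dependence on s cancels. *)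
have key s w : 0 < s <= 1 -> X (z + w) ->
    dotp (gradient h (u s)) w <= h (z + w) - h y - a.
  move=> s01 Xw; have := uX s s01 => us; have /andP[s0 s1] := s01.
  have s01' : 0 <= s <= 1 by rewrite (ltW s0).
  have := bregman_ge0 ch Xw (interior_subset us) (dh _ us).
  have := bregman_ge0 ch Xy (interior_subset us) (dh _ us).
  have := bregman_argmin_segment cK ymin Kz s01'; rewrite -/a -/(u s).
  rewrite /bregman.
  have -> : z + w - u s = w + (1 - s) *: (z - y).
    by rewrite /u scalerBl scale1r opprD !addrA [z + w]addrC.
  have -> : y - u s = (- s) *: (z - y).
    by rewrite /u opprD addrA subrr sub0r scaleNr.
  rewrite dotpDr !dotpZr; set G := dotp _ (z - y) => H1 H2 H3.
  have aG : a <= G by rewrite -(ler_pM2l s0); lra.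
  nra.
(* Testing key in the directions w j and - w j bounds each coordinate. *)
pose w j : 'rV[R]_d := (r / 2) *: delta_mx 0 j.
have wr j : `|w j| < r.
  have d1 : `|delta_mx 0 j : 'rV[R]_d| <= 1.
    rewrite [leLHS]mx_normrE; apply/bigmax_leP; split => // i _.
    by rewrite mxE; case: (_ && _); rewrite ?normr1 ?normr0.
  rewrite /w normrZ gtr0_norm ?divr_gt0//.
  by apply: (@le_lt_trans _ _ (r / 2)); [rewrite ler_piMr// ltW// divr_gt0|lra].
pose B j := (`|h (z + w j)| + `|h (z - w j)| + `|h y| + `|a|) / (r / 2).
have gB s j : 0 < s <= 1 -> `|gradient h (u s) 0 j| <= B j.
  move=> s01; rewrite /B ler_pdivlMr ?divr_gt0// -[r / 2 in leLHS]gtr0_norm ?divr_gt0//.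
  rewrite -normrM mulrC -(dotp_delta (gradient _ _)) -dotpZr -/(w j).
  have := key s _ s01 (rX _ (wr j)).
  have := key s (- w j) s01; rewrite -(scaleN1r (w j)) dotpZr scaleN1r.
  move=> /(_ (rX _ _)); rewrite normrN => /(_ (wr j)) H1 H2.
  have := ler_norm (h (z + w j)); have := ler_norm (h (z - w j)).
  have := ler_norm (- h y); have := ler_norm (- a); rewrite !normrN.
  have := normr_ge0 (h (z + w j)); have := normr_ge0 (h (z - w j)).
  move=> *; rewrite ler_norml; apply/andP; split; lra.
pose M := Num.sqrt (\sum_j B j ^+ 2).
have eM s : 0 < s <= 1 -> enorm (gradient h (u s)) <= M.
  move=> s01; rewrite /enorm /M ler_wsqrtr// dotpE ler_sum// => j _.
  by rewrite -expr2 -[leLHS]real_normK ?num_real// lerXn2r ?nnegrE ?(le_trans _ (gB _ _ s01)) ?gB.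
have harm01 k : 0 < (@harmonic R k) <= 1.
  by rewrite /harmonic/= invr_gt0 ltr0Sn/= invf_le1 ?ltr0Sn// ler1n.
have cu : u (@harmonic R k) @[k --> \oo] --> y.
  rewrite -[X in _ --> X]addr0 -(scale0r (z - y)).
  apply: cvgD; first exact: cvg_cst.
  by apply: cvgZr_tmp; exact: cvg_harmonic.
have := blowup (fun k => u (@harmonic R k)) y (fun k => uX _ (harm01 k)) _ cu.
move=> /(_ (conj (subset_closure Xy) yNint)) /cvgryPgt /(_ M).
move=> [N _ /(_ N (leqnn N))] /=.
by rewrite ltNge eM// harm01.
Qed.
End Gradient.

Lemma convex_set_hyperplane_section {R : realType} {d : nat}
    (A : set 'rV[R]_d) (v x : 'rV[R]_d) (b c : R) :
  convex_set A -> convex_set [set q | A q /\ b + dotp v (q - x) = c].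
Proof.
move=> cA p q l; rewrite !inE => -[Ap vp] [Aq vq]; split.
  by have := cA p q l; rewrite !inE; apply.
rewrite /conv/= !(dotpBr, dotpDr, dotpZr) in vp vq *.
have -> : c = l%:num * c + (1 - l%:num) * c by ring.
by rewrite -{1}vp -vq /unstable.onem; ring.
Qed.

(** With G the difference of the gradients of [h] at [y] and [x], the claims are
    a lower bound on the pairings of G with x - y and with p - y. The segment
    from [x] to [p] meets the hyperplane at a point z, and the pairing of G with
    z - y is nonnegative and a convex combination of the other two. So lam can
    be defined by equality in the bound at [x], and the bound at [p] follows. *)
Lemma bregman_projection_multiplier {R : realType} {d : nat}
    (X A : set 'rV[R]_d) (h : 'rV[R]_d -> R) (v x y p : 'rV[R]_d) (b c : R) :
  convex_set X -> convex_function X h -> essentially_smooth X h ->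
  convex_set A -> A `<=` X ->
  is_argmin [set q | A q /\ b + dotp v (q - x) = c]
    (fun q => bregman h q x) y ->
  (A `&` X°) x -> (A `&` X°) p -> b + dotp v (p - x) <= c <= b ->
  [/\ A y, X° y & exists lam : R, [/\ 0 <= lam,
      bregman h y x <= lam * (b - c) &
      bregman h p y + bregman h y x <=
        bregman h p x - lam * (c - (b + dotp v (p - x)))]].
Proof.
move=> cX ch hsmooth cA AX ymin [Ax xX] [Ap pX] /andP[apc cb].
set K := [set q | _] in ymin.
have cK : convex_set K by exact: convex_set_hyperplane_section.
have KX : K `<=` X by move=> q [/AX].
have [_ dh _] := hsmooth.
have [[Ay ay] yle] := ymin.
set ap := b + _ in apc *.
have apE : dotp v (p - x) = ap - b by rewrite /ap; ring.
move: cb; rewrite le_eqVlt => /predU1P[cbE|cb].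
  (* Here x already lies on the hyperplane, so y has zero divergence from x and
     minimises it over all of X; the multiplier is 0. *)
  have Kx : K x by split; rewrite // cbE subrr /dotp trmx0 mulmx0 mxE addr0.
  have yX : X° y.
    by apply: (bregman_argmin_interior cX ch hsmooth cK KX ymin (z := x)).
  have D0 : bregman h y x <= 0.
    have := yle _ Kx; rewrite {2}/bregman !subrr.
    by rewrite /dotp trmx0 mulmx0 mxE subr0.
  split=> //; exists 0; split; rewrite ?mul0r ?subr0//.
  have yminX : is_argmin X (fun q => bregman h q x) y.
    split; first exact: AX.
    move=> q Xq; apply: (le_trans D0).
    exact: (bregman_ge0 ch Xq (AX _ Ax) (dh _ xX)).
  have := bregman_argmin_variational cX yminX (dh _ yX) (AX _ Ap).
  have := bregman_three_points h p y x; lra.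
pose s := (b - c) / (b - ap).
have bap : 0 < b - ap by lra.
have sE : s * (b - ap) = b - c by rewrite /s divfK// gt_eqF.
have s0 : 0 < s by rewrite divr_gt0// subr_gt0.
have s1 : s <= 1 by rewrite ler_pdivrMr//; lra.
have s01 : 0 <= s <= 1 by rewrite (ltW s0).
pose z := x + s *: (p - x).
have Kz : K z.
  split; first exact: convex_set_segment.
  by rewrite /z (addrAC x) subrr add0r dotpZr apE; lra.
have zX : X° z.
  by apply: convex_set_segment_interior => //; rewrite ?s0//; exact: AX.
have yX : X° y.
  by apply: (bregman_argmin_interior cX ch hsmooth cK KX ymin (z := z)).
split=> //.
have := bregman_argmin_variational cK ymin (dh _ yX) Kz.
have -> : z - y = (1 - s) *: (x - y) + s *: (p - y).
  rewrite /z scalerBl scale1r -[in RHS]addrA [- _ + _]addrC -scalerBr opprB.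
  by rewrite [p - y + _]addrA subrK addrAC.
rewrite dotpDr !dotpZr.
have := bregman_symm h y x; have := bregman_three_points h p y x.
have := bregman_ge0 ch (AX _ Ay) (AX _ Ax) (dh _ xX).
have := bregman_ge0 ch (AX _ Ax) (AX _ Ay) (dh _ yX).
set u := dotp _ (p - y); set w := dotp _ (x - y) => Dxy Dyx three symm zge.
have bc0 : 0 < b - c by rewrite subr_gt0.
exists (- w / (b - c)); split.
- by rewrite divr_ge0 ?(ltW bc0)//; lra.
- by rewrite divfK ?gt_eqF//; lra.
- have : - w / (b - c) * (c - ap) <= u.
    rewrite mulrAC ler_pdivrMr//; nra.
  lra.
Qed.

(** * Balancing two contraction rates *)

(** [delta] contracts at rate L * lam and [D] at rate 1 - lam * mu. Relative to
    rho = L / (L + mu), both excess factors are at most exponentials, by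
    1 + u <= exp u, and the exponents are L * tau and - mu * tau for the same
    tau. They accumulate to L * T and - mu * T, and whichever is nonpositive
    gives the bound. *)
Lemma two_rate_contraction {R : realType} (delta D : nat -> R) (L mu : R) :
  0 < L -> 0 < mu -> (forall t, 0 <= delta t) -> (forall t, 0 <= D t) ->
  (forall t, exists lam e : R, [/\ 0 <= e, delta t.+1 <= L * e,
     e <= lam * delta t & D t.+1 + e <= (1 - lam * mu) * D t]) ->
  forall t, delta t <=
    (1 - mu / (L + mu)) ^+ t * Num.max (delta 0%N) (L * D 0%N).
Proof.
move=> L0 mu0 delta0 D0 step t.
have Lmu : 0 < L + mu by rewrite addr_gt0.
set rho := 1 - _; set M := Num.max _ _.
have rhoE : rho * (L + mu) = L.
  by rewrite /rho mulrBl divfK ?gt_eqF//; ring.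
have rho0 : 0 < rho by rewrite -(pmulr_lgt0 _ Lmu) rhoE.
have M0 : 0 <= M by rewrite le_max delta0.
have [T [bL bmu _]] : exists T, [/\ delta t <= rho ^+ t * expR (L * T) * M,
    delta t <= rho ^+ t * expR (- mu * T) * M &
    L * D t <= rho ^+ t * expR (- mu * T) * M].
  elim: t => [|t [T [bL bmu bD]]].
    exists 0; rewrite !mulr0 expR0 expr0 !mul1r.
    by rewrite /M !le_max !lexx orbT.
  have [lam [e [e0 de ed De]]] := step t.
  pose tau := ((L + mu) * lam - 1) / L.
  have aL : L * lam <= rho * expR (L * tau).
    have : L * lam = rho * (1 + L * tau).
      by rewrite -[L in LHS]rhoE /tau mulrC; field; rewrite gt_eqF.
    by move=> ->; rewrite ler_pM2l// expR_ge1Dx.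
  have bmu' : 1 - lam * mu <= rho * expR (- mu * tau).
    have : 1 - lam * mu = rho * (1 + - mu * tau).
      rewrite /tau /rho; field; rewrite !gt_eqF//.
    by move=> ->; rewrite ler_pM2l// expR_ge1Dx.
  have step_mu : L * (D t.+1 + e) <=
      rho ^+ t.+1 * expR (- mu * (T + tau)) * M.
    apply: (@le_trans _ _ (rho * expR (- mu * tau) * (L * D t))).
      rewrite mulrCA ler_pM2l//; apply: (le_trans De).
      by rewrite ler_wpM2r.
    rewrite mulrDr expRD exprS.
    have -> : rho * rho ^+ t * (expR (- mu * T) * expR (- mu * tau)) * M =
      rho * expR (- mu * tau) * (rho ^+ t * expR (- mu * T) * M) by ring.
    by rewrite ler_wpM2l// mulr_ge0 ?expR_ge0 ?ltW.
  exists (T + tau); split.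
  - apply: (@le_trans _ _ (rho * expR (L * tau) * delta t)).
      apply: (le_trans de); apply: (@le_trans _ _ (L * (lam * delta t))).
        by rewrite ler_pM2l.
      by rewrite mulrA ler_wpM2r.
    rewrite mulrDr expRD exprS.
    have -> : rho * rho ^+ t * (expR (L * T) * expR (L * tau)) * M =
      rho * expR (L * tau) * (rho ^+ t * expR (L * T) * M) by ring.
    by rewrite ler_wpM2l// mulr_ge0 ?expR_ge0 ?ltW.
  - apply: le_trans step_mu; apply: (le_trans de).
    by rewrite ler_pM2l// lerDr.
  - by apply: le_trans step_mu; rewrite ler_pM2l// lerDl.
have rM : 0 <= rho ^+ t * M by rewrite mulr_ge0// exprn_ge0// ltW.
have [T0|/ltW T0] := leP T 0.
  apply: (le_trans bL); rewrite mulrAC ler_piMr// -expR0 ler_expR.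
  by rewrite mulr_ge0_le0// ltW.
apply: (le_trans bmu); rewrite mulrAC ler_piMr// -expR0 ler_expR.
by rewrite mulNr oppr_le0 mulr_ge0// ltW.
Qed.

(** * The convergence rate *)

Theorem theorem7 (R : realType) (d : nat) (X C : set 'rV[R]_d)
    (f h : 'rV[R]_d -> R) (g : 'rV[R]_d -> 'rV[R]_d)
    (xstar : 'rV[R]_d) (x : nat -> 'rV[R]_d) (L mu : R)
    (X_convex : convex_set X) (X_int : X° !=set0)
    (f_convex : convex_function X f)
    (C_closed : closed C) (C_convex : convex_set C)
    (xstar_min : is_argmin (X `&` C) f xstar)
    (g_subgradient : forall y : 'rV[R]_d, X° y -> subdifferential X f y (g y))
    (h_legendre : legendre_type X h)
    (x_iterates : mirror_polyak X C f g h (f xstar) x)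
    (xstar_ri : (relative_interior C `&` X°) xstar)
    (L_gt0 : 0 < L) (mu_gt0 : 0 < mu)
    (f_smooth : relatively_smooth X f g h L)
    (f_strongly_convex : relatively_strongly_convex X f g h mu) :
  forall t : nat,
    f (x t) - f xstar <=
      (1 - mu / (L + mu)) ^+ t *
      Num.max (f (x 0%N) - f xstar) (L * bregman h xstar (x 0%N)).
Proof.
have [x0CX iter] := x_iterates.
have [h_convex _ h_smooth _] := h_legendre.
have [_ dh _] := h_smooth.
have [[Xs Cs] fmin] := xstar_min.
have [_ sX] := xstar_ri.
have cXC : convex_set (X `&` C).
  move=> p q l; rewrite !inE => -[Xp Cp] [Xq Cq]; split.
    by have := X_convex p q l; rewrite !inE; apply.
  by have := C_convex p q l; rewrite !inE; apply.
have XCX : X `&` C `<=` X by move=> ? [].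
(* Strong convexity puts xstar below the hyperplane by at least mu * D_t, which
   is what makes the multiplier contract D_t. *)
have polyak_level t : X° (x t) ->
    f (x t) + dotp (g (x t)) (xstar - x t) + mu * bregman h xstar (x t)
      <= f xstar.
  by move=> xX; exact: f_strongly_convex.
have D0 t : X° (x t) -> 0 <= bregman h xstar (x t).
  move=> xX.
  exact: (bregman_ge0 h_convex Xs (interior_subset xX) (dh _ xX)).
have step t : ((X `&` C) `&` X°) (x t) ->
    ((X `&` C) `&` X°) (x t.+1) /\ exists lam : R, [/\ 0 <= lam,
      bregman h (x t.+1) (x t) <= lam * (f (x t) - f xstar) &
      bregman h xstar (x t.+1) + bregman h (x t.+1) (x t) <=
        bregman h xstar (x t) - lam * (f xstar -
          (f (x t) + dotp (g (x t)) (xstar - x t)))].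
  move=> [XCx xX].
  have mD := D0 _ xX; have lev := polyak_level _ xX.
  have level : f (x t) + dotp (g (x t)) (xstar - x t) <= f xstar <= f (x t).
    rewrite fmin// andbT.
    have := mulr_ge0 (ltW mu_gt0) mD; lra.
  have [] := bregman_projection_multiplier X_convex h_convex h_smooth cXC XCX
    (iter t) (conj XCx xX) (conj (conj Xs Cs) sX) level.
  by split.
have xin t : ((X `&` C) `&` X°) (x t).
  elim: t => [|t /step[]//].
  by case: x0CX => Cx /[dup] /interior_subset.
apply: (two_rate_contraction (D := fun t => bregman h xstar (x t))
  (delta := fun t => f (x t) - f xstar)) => // t.
- by rewrite subr_ge0 fmin//; case: (xin t).
- by apply: D0; case: (xin t).
have [XCx xX] := xin t; have [XCy yX] := xin t.+1.
have [_ [lam [lam0 elam De]]] := step t (xin t).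
exists lam, (bregman h (x t.+1) (x t)); split => //.
- exact: (bregman_ge0 h_convex (XCX _ XCy) (interior_subset xX) (dh _ xX)).
- have := f_smooth _ _ xX (XCX _ XCy).
  have [[_ ->] _] := iter t; lra.
- apply: (le_trans De); rewrite mulrBl mul1r lerD2l lerN2 -mulrA ler_wpM2l//.
  by have := polyak_level _ xX; lra.
Qed.
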